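(* Let $A\in\mathbb{R}^{m\times p}$ have no zero rows, let $B\in\mathbb{R}^{q\times n}$ have full row rank, let $C\in\mathbb{R}^{m\times n}$, and let $\widetilde C=CB^T(BB^T)^{-1}$. One cycle $X^s\mapsto X^{s+1}$ of the BK method for $AX=\widetilde C$ (defined in the context) with parameter $\alpha\ne0$ can be written as $$X^{s+1}=X^s+A^TL_\alpha^{-1}\,(\widetilde C-AX^s),\qquad L_\alpha=\mathrm{slt}(AA^T)+\alpha^{-1}\,\mathrm{diag}(AA^T).$$ If $\alpha\in(0,2)$, then this method is convergent and $\rho(I_p-A^TL_\alpha^{-1}A)<1$. In addition: (a) If $AXB=C$ is consistent, the process converges to a solution of this matrix equation. (b) If $AXB=C$ is consistent, $\mathrm{range}(X^0)\subseteq\mathrm{range}(A^T)$ and $\mathrm{range}((X^0)^T)\subseteq\mathrm{range}(B)$, then the method converges to the minimum norm solution $A^+\widetilde C$ $(=A^+CB^+)$.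
   Context: $M_{i,:}$ denotes the $i$th row of a matrix $M$ (a row vector), $A_{i,:}^T$ the transpose of the $i$th row of $A$, $\|\cdot\|$ the 2-norm, $M^+$ the Moore--Penrose pseudoinverse, $\mathrm{range}(M)$ the range (column) space, $I_p$ the $p\times p$ identity matrix, and $\rho$ the spectral radius. $\mathrm{slt}(AA^T)$ and $\mathrm{diag}(AA^T)$ denote the strictly lower triangular part and the diagonal part of $AA^T$. The equation $AXB=C$, with unknown $X\in\mathbb{R}^{p\times q}$, is consistent if it has at least one solution; its minimum norm solution is the solution of smallest Frobenius norm. When $B$ has full row rank, the equation $AXB=C$ is reformulated as $AX=\widetilde C$ with $\widetilde C=CB^T(BB^T)^{-1}$. BK (block Kaczmarz) method with $B$ of full row rank (relaxation parameter $\alpha$, initial guess $X^0\in\mathbb{R}^{p\times q}$): for $s=0,1,2,\dots$, set $X^{s,0}=X^s$; compute $$X^{s,i}=X^{s,i-1}+\frac{\alpha}{\|A_{i,:}\|^2}\,A_{i,:}^T\,\big(\widetilde C_{i,:}-A_{i,:}X^{s,i-1}\big),\qquad i=1,\dots,m;$$ set $X^{s+1}=X^{s,m}$. One such pass through all $m$ rows is called a cycle (or sweep).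
   Formalization: The claim ρ(I_p − AᵀL_α⁻¹A) < 1 fails if rank A < p (A = [1 0], α = 1 gives ρ = 1); it is proved when A has full column rank, and for every A for the restriction of the matrix to range(Aᵀ). *)

(* Defs.v *)
From HB Require Import structures.
From mathcomp Require Import all_boot all_order all_algebra.
From mathcomp Require Import complex.
From mathcomp Require Import boolp classical_sets reals topology normedtype.

Set Implicit Arguments.
Unset Strict Implicit.
Unset Printing Implicit Defensive.

Import Order.TTheory GRing.Theory Num.Theory.
Import numFieldNormedType.Exports.

Local Open Scope classical_set_scope.
Local Open Scope ring_scope.

Section Defs.
Variable R : realType.

(* On a row vector this is the 2-norm. *)
Definition frobenius_norm m n (M : 'M[R]_(m, n)) : R :=
  Num.sqrt (\sum_i \sum_j M i j ^+ 2).

(* range(M) is included in range(N); the %MS operations compare row spaces,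
   whence the transpositions. *)
Definition range_sub m k l (M : 'M[R]_(m, k)) (N : 'M[R]_(m, l)) : bool :=
  (M^T <= N^T)%MS.

Definition strict_lower m (M : 'M[R]_m) : 'M[R]_m :=
  \matrix_(i, j) (if (j < i)%N then M i j else 0).

Definition diag_part m (M : 'M[R]_m) : 'M[R]_m := diag_mx (\row_i M i i).

Definition Lmx m p (alpha : R) (A : 'M[R]_(m, p)) : 'M[R]_m :=
  strict_lower (A *m A^T) + alpha^-1 *: diag_part (A *m A^T).

Definition Ctilde m n q (B : 'M[R]_(q, n)) (C : 'M[R]_(m, n)) : 'M[R]_(m, q) :=
  C *m B^T *m invmx (B *m B^T).

Definition BK_step m p q (alpha : R) (A : 'M[R]_(m, p)) (D : 'M[R]_(m, q))
    (X : 'M[R]_(p, q)) (i : 'I_m) : 'M[R]_(p, q) :=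
  X + (alpha / frobenius_norm (row i A) ^+ 2) *:
        ((row i A)^T *m (row i D - row i A *m X)).

(* [enum 'I_m] lists the rows in increasing order. *)
Definition BK_cycle m p q (alpha : R) (A : 'M[R]_(m, p)) (D : 'M[R]_(m, q))
    (X : 'M[R]_(p, q)) : 'M[R]_(p, q) :=
  foldl (BK_step alpha A D) X (enum 'I_m).

Definition BK m p q (alpha : R) (A : 'M[R]_(m, p)) (D : 'M[R]_(m, q))
    (X0 : 'M[R]_(p, q)) (s : nat) : 'M[R]_(p, q) :=
  iter s (BK_cycle alpha A D) X0.

Definition is_solution m n p q (A : 'M[R]_(m, p)) (B : 'M[R]_(q, n))
    (C : 'M[R]_(m, n)) (X : 'M[R]_(p, q)) : Prop :=
  A *m X *m B = C.

Definition consistent m n p q (A : 'M[R]_(m, p)) (B : 'M[R]_(q, n))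
    (C : 'M[R]_(m, n)) : Prop :=
  exists X : 'M[R]_(p, q), is_solution A B C X.

Definition is_min_norm_solution m n p q (A : 'M[R]_(m, p)) (B : 'M[R]_(q, n))
    (C : 'M[R]_(m, n)) (X : 'M[R]_(p, q)) : Prop :=
  is_solution A B C X /\
  forall Y : 'M[R]_(p, q), is_solution A B C Y -> Y != X ->
    frobenius_norm X < frobenius_norm Y.

(* The eigenvalues are the complex ones. The empty matrix has none, and [sup]
   gives it spectral radius 0. *)
Definition spectral_radius p (M : 'M[R]_p) : R :=
  sup [set ComplexField.Normc.normc z | z in
        [set z : R[i] | eigenvalue (map_mx (real_complex R) M) z]].

(* Spectral radius of the restriction of x |-> M x to range(V), for M mapping
   range(V) into itself. [restrictmx] restricts the action on row vectors to a
   row space, whence the transpositions. *)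
Definition spectral_radius_on p k (V : 'M[R]_(p, k)) (M : 'M[R]_p) : R :=
  spectral_radius (restrictmx V^T M^T).

Definition penrose m n (M : 'M[R]_(m, n)) (P : 'M[R]_(n, m)) : Prop :=
  [/\ M *m P *m M = M, P *m M *m P = P,
      (M *m P)^T = M *m P & (P *m M)^T = P *m M].

(* The Moore--Penrose pseudoinverse; MathComp's [pinvmx] is only a partial
   inverse. *)
Definition mpinv m n (M : 'M[R]_(m, n)) : 'M[R]_(n, m) := xget 0 (penrose M).

Lemma gram_unit k n (M : 'M[R]_(k, n)) : row_free M -> M *m M^T \in unitmx.
Proof.
move=> fM; rewrite -row_free_unit; apply/row_freeP.
have kerG : kermx (M *m M^T) = 0.
  apply/row_matrixP => i; rewrite row0.
  set v := row i _.
  have vG : v *m (M *m M^T) = 0.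
    by rewrite /v -row_mul mulmx_ker row0.
  have w0 : v *m M = 0.
    have H : (v *m M) *m (v *m M)^T = 0.
      by rewrite trmx_mul mulmxA -(mulmxA v) vG mul0mx.
    apply/rowP => j; rewrite [RHS]mxE.
    move/matrixP: H => /(_ 0 0); rewrite mxE [RHS]mxE => /eqP.
    under eq_bigr do rewrite [X in _ * X]mxE -expr2.
    rewrite psumr_eq0; last by move=> l _; exact: sqr_ge0.
    by move/allP => /(_ j (mem_index_enum j)) /=; rewrite sqrf_eq0 => /eqP.
  by have /(row_free_inj fM) : v *m M = 0 *m M by rewrite w0 mul0mx.
by apply/row_freeP; rewrite -kermx_eq0 kerG.
Qed.

Lemma penrose_uniq m n (M : 'M[R]_(m, n)) P Q :
  penrose M P -> penrose M Q -> P = Q.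
Proof.
move=> [P1 P2 P3 P4] [Q1 Q2 Q3 Q4].
have MPQ : M *m P = M *m Q.
  by rewrite -P3 -[in LHS]Q1 -(mulmxA (M *m Q)) trmx_mul P3 Q3 mulmxA P1.
have PMQ : P *m M = Q *m M.
  by rewrite -P4 -[in LHS]Q1 -(mulmxA M) mulmxA trmx_mul P4 Q4
     -!mulmxA (mulmxA M P) P1.
by rewrite -P2 -mulmxA MPQ mulmxA PMQ Q2.
Qed.

Lemma penrose_fact m n r (F : 'M[R]_(m, r)) (G : 'M[R]_(r, n)) :
  F^T *m F \in unitmx -> G *m G^T \in unitmx ->
  penrose (F *m G)
    (G^T *m invmx (G *m G^T) *m (invmx (F^T *m F) *m F^T)).
Proof.
move=> uF uG; set Gi := G^T *m _; set Fi := _ *m F^T.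
have GGi : G *m Gi = 1%:M by rewrite mulmxA mulmxV.
have FiF : Fi *m F = 1%:M by rewrite -mulmxA mulVmx.
have MP : F *m G *m (Gi *m Fi) = F *m Fi.
  by rewrite mulmxA -(mulmxA F G) GGi mulmx1.
have PM : Gi *m Fi *m (F *m G) = Gi *m G.
  by rewrite mulmxA -(mulmxA Gi) FiF mulmx1.
split.
- by rewrite MP mulmxA -(mulmxA F) FiF mulmx1.
- by rewrite PM mulmxA -(mulmxA Gi) GGi mulmx1.
- by rewrite MP /Fi !trmx_mul trmxK trmx_inv trmx_mul trmxK mulmxA.
- by rewrite PM /Gi !trmx_mul trmxK trmx_inv trmx_mul trmxK mulmxA.
Qed.

Lemma penrose_exists m n (M : 'M[R]_(m, n)) : exists P, penrose M P.
Proof.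
have uG := gram_unit (row_base_free M).
have uF : (col_base M)^T *m col_base M \in unitmx.
  rewrite -[X in _ *m X]trmxK; apply: gram_unit.
  by rewrite -row_leq_rank mxrank_tr col_leq_rank col_base_full.
have := penrose_fact uF uG; rewrite mulmx_base => MP.
by eexists; exact: MP.
Qed.

Lemma mpinvP m n (M : 'M[R]_(m, n)) : penrose M (mpinv M).
Proof. exact: (xgetPex 0 (penrose_exists M)). Qed.

End Defs.

(* Main.v *)
Require Import Defs.
From HB Require Import structures.
From mathcomp Require Import all_boot all_order all_algebra.
From mathcomp Require Import complex.
From mathcomp Require Import boolp classical_sets reals topology normedtype.
From mathcomp Require Import sequences ring lra.

Set Implicit Arguments.
Unset Strict Implicit.
Unset Printing Implicit Defensive.

Import Order.TTheory GRing.Theory Num.Theory.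
Import numFieldNormedType.Exports.

Local Open Scope classical_set_scope.
Local Open Scope ring_scope.

(** Write [H] for [A^T L^-1], [M] for [1 - H A], and [P] for [A^+ A], the
    orthogonal projection onto range(A^T).

    A cycle adds to [X] a combination [A^T Z] of the rows of [A]. The i-th step
    contributes a multiple of the i-th row by a row [z_i] that depends on the
    earlier [z_j] through the residual, and these dependences form exactly the
    lower triangular system [L Z = D - A X] ([BK_partial_cycle]).

    Convergence is an energy identity. Since [L + L^T - A A^T] is the diagonal
    matrix [W = (2 / alpha - 1) diag(A A^T)], which is positive definite for
    0 < alpha < 2, the squared Frobenius norm satisfies
    [|M X|^2 = |X|^2 - |W^(1/2) Z|^2], where [Z = L^-1 A X]
    ([sqnorm_sweep]). If [P X = X], then [X = A^+ A X = A^+ L Z] is a fixed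
    linear image of [W^(1/2) Z], so the loss is at least a fixed fraction of
    [|X|^2]: [M] is a strict contraction of range(A^T) ([sweep_contraction]).

    Everything else follows from this. A complex eigenvalue of [M] on
    range(A^T) has an eigenvector [a + i b], and adding the contraction
    estimates of its real and imaginary parts bounds the modulus of the
    eigenvalue ([spectral_radius_lt1]). The contraction makes [1 - M P]
    invertible, which yields a matrix [Y] with columns in range(A^T) and
    [H (D - A Y) = 0], consistent or not ([sweep_fixed]). The error to
    [X0 - P X0 + Y] starts in range(A^T) and is multiplied by [M] at each cycle,
    so the iterates converge to that matrix ([BK_cvg]). In the consistent case
    one can take [Y = A^+ D], for which [A Y = D]; and [P X0 = X0] when the
    columns of [X0] are in range(A^T). Minimality of [A^+ D] is Pythagoras for
    the projection [P]. *)

(** * Squared Frobenius norm *)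

Section SquaredFrobeniusNorm.
Variable R : realType.

(** The trace form turns energy estimates into matrix algebra; [sqnormE] gives
    back the sum of the squared entries. *)
Definition sqnorm m n (X : 'M[R]_(m, n)) : R := \tr (X^T *m X).

Lemma sqnormE m n (X : 'M[R]_(m, n)) : sqnorm X = \sum_i \sum_j X i j ^+ 2.
Proof.
rewrite /sqnorm /mxtrace exchange_big /=; apply: eq_bigr => j _.
by rewrite mxE; apply: eq_bigr => i _; rewrite mxE expr2.
Qed.

Lemma frobenius_normE m n (X : 'M[R]_(m, n)) :
  frobenius_norm X = Num.sqrt (sqnorm X).
Proof. by rewrite sqnormE. Qed.

Lemma sqnorm_ge0 m n (X : 'M[R]_(m, n)) : 0 <= sqnorm X.
Proof.
rewrite sqnormE sumr_ge0// => i _.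
by rewrite sumr_ge0// => j _; exact: sqr_ge0.
Qed.

Lemma sqnorm_eq0 m n (X : 'M[R]_(m, n)) : (sqnorm X == 0) = (X == 0).
Proof.
apply/idP/eqP => [|->]; last by rewrite /sqnorm mulmx0 mxtrace0.
rewrite sqnormE psumr_eq0 => [|i _]; last first.
  by rewrite sumr_ge0// => j _; exact: sqr_ge0.
move/allP => X0; apply/matrixP => i j; rewrite mxE.
have := X0 i (mem_index_enum i).
rewrite psumr_eq0 => [|k _]; last exact: sqr_ge0.
by move=> /allP/(_ j (mem_index_enum j)); rewrite /= sqrf_eq0 => /eqP.
Qed.

Lemma sqnorm_gt0 m n (X : 'M[R]_(m, n)) : (0 < sqnorm X) = (X != 0).
Proof. by rewrite lt_def sqnorm_ge0 andbT sqnorm_eq0. Qed.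

Lemma sqnorm_tr m n (X : 'M[R]_(m, n)) : sqnorm X^T = sqnorm X.
Proof. by rewrite /sqnorm trmxK mxtrace_mulC. Qed.

Lemma sqnormD m n (X Y : 'M[R]_(m, n)) :
  sqnorm (X + Y) = sqnorm X + sqnorm Y + 2 * \tr (X^T *m Y).
Proof.
have YX : \tr (Y^T *m X) = \tr (X^T *m Y).
  by rewrite -mxtrace_tr trmx_mul trmxK.
by rewrite /sqnorm [(_ + _)^T]linearD/= mulmxDl !mulmxDr !mxtraceD YX; ring.
Qed.

Lemma sqr_entry_le m n (X : 'M[R]_(m, n)) i j : X i j ^+ 2 <= sqnorm X.
Proof.
rewrite sqnormE (bigD1 i)//= (bigD1 j)//= -addrA lerDl addr_ge0//.
  by rewrite sumr_ge0// => k _; exact: sqr_ge0.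
by rewrite sumr_ge0// => k _; rewrite sumr_ge0// => l _; exact: sqr_ge0.
Qed.

(** Lagrange's identity: the gap is half the sum of the squared 2 x 2 minors. *)
Lemma cauchy_schwarz (I : finType) (a b : I -> R) :
  (\sum_i a i * b i) ^+ 2 <= (\sum_i a i ^+ 2) * (\sum_i b i ^+ 2).
Proof.
have : 0 <= \sum_i \sum_j (a i * b j - a j * b i) ^+ 2.
  by rewrite sumr_ge0// => i _; rewrite sumr_ge0// => j _; exact: sqr_ge0.
have -> : \sum_i \sum_j (a i * b j - a j * b i) ^+ 2 =
    \sum_i \sum_j (a i ^+ 2 * b j ^+ 2) + \sum_i \sum_j (a j ^+ 2 * b i ^+ 2)
    - 2 * (\sum_i \sum_j (a i * b i) * (a j * b j)).
  rewrite mulr_sumr -sumrN -!big_split/=; apply: eq_bigr => i _.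
  by rewrite mulr_sumr -sumrN -!big_split/=; apply: eq_bigr => j _; ring.
rewrite [X in _ + X - _]exchange_big/= -!big_distrlr/= -expr2.
by set x := _ ^+ 2; set y := _ * _; lra.
Qed.

Lemma sqnorm_mulmx m n k (X : 'M[R]_(m, n)) (Y : 'M[R]_(n, k)) :
  sqnorm (X *m Y) <= sqnorm X * sqnorm Y.
Proof.
rewrite -(sqnorm_tr Y) !sqnormE mulr_suml ler_sum// => i _.
rewrite mulr_sumr ler_sum// => j _; rewrite mxE.
apply: le_trans (cauchy_schwarz _ _) _.
by under [X in _ <= _ * X]eq_bigr do rewrite mxE.
Qed.

(** This is multiplicativity of the norm for the product of [x + i y] with
    [X + i Y], written with real and imaginary parts so that real contraction
    estimates bound complex eigenvalues. *)
Lemma sqnorm_complexZ m n (x y : R) (X Y : 'M[R]_(m, n)) :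
  sqnorm (x *: X - y *: Y) + sqnorm (x *: Y + y *: X) =
  (x ^+ 2 + y ^+ 2) * (sqnorm X + sqnorm Y).
Proof.
rewrite !sqnormE -!big_split mulr_sumr; apply: eq_bigr => i _.
rewrite -!big_split mulr_sumr; apply: eq_bigr => j _.
by rewrite /= !mxE; ring.
Qed.

End SquaredFrobeniusNorm.

(** * The pseudoinverse and the reduced equation *)

Section Pseudoinverse.
Variable R : realType.

Lemma mulmx_proj m p (A : 'M[R]_(m, p)) : A *m (mpinv A *m A) = A.
Proof. by case: (mpinvP A) => AA _ _ _; rewrite mulmxA. Qed.

Lemma proj_trmx m p (A : 'M[R]_(m, p)) : mpinv A *m A *m A^T = A^T.
Proof.
have PT : (mpinv A *m A)^T = mpinv A *m A by case: (mpinvP A).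
by rewrite -PT -trmx_mul mulmx_proj.
Qed.

Lemma proj_idem m p (A : 'M[R]_(m, p)) :
  mpinv A *m A *m (mpinv A *m A) = mpinv A *m A.
Proof. by rewrite -mulmxA mulmx_proj. Qed.

Lemma mpinv_row_free q n (B : 'M[R]_(q, n)) :
  row_free B -> mpinv B = B^T *m invmx (B *m B^T).
Proof.
move=> /gram_unit uB; apply: (penrose_uniq (mpinvP B)).
(* B = 1 B is a full rank factorization *)
have u1 : (1%:M : 'M[R]_q)^T *m 1%:M \in unitmx by rewrite trmx1 mul1mx unitmx1.
have := penrose_fact u1 uB.
by rewrite trmx1 !mul1mx invmx1 !mulmx1.
Qed.

(** Right multiplication by [B^T (B B^T)^-1] undoes [B] and turns the equation
    into [A X = Ctilde B C]. The way back needs consistency: it forces the rows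
    of [C] into the row space of [B]. *)
Lemma Ctilde_sol m n p q (A : 'M[R]_(m, p)) (B : 'M[R]_(q, n)) C
    (X : 'M[R]_(p, q)) :
  row_free B -> is_solution A B C X <->
  A *m X = Ctilde B C /\ consistent A B C.
Proof.
move=> /gram_unit uB.
have sol Y : is_solution A B C Y -> Ctilde B C = A *m Y.
  move=> <-; rewrite /Ctilde -(mulmxA (A *m Y) B) -(mulmxA (A *m Y)).
  by rewrite mulmxV// mulmx1.
split=> [XC|[AX [Y YC]]]; first by split; [rewrite (sol _ XC)|exists X].
by rewrite /is_solution AX (sol _ YC).
Qed.

(** Pythagoras: [A^+ D = P Y], so [Y] splits orthogonally as [A^+ D] plus
    [Y - P Y]. *)
Lemma min_norm_mpinv m p q (A : 'M[R]_(m, p)) (D : 'M[R]_(m, q))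
    (Y : 'M[R]_(p, q)) :
  A *m Y = D -> Y != mpinv A *m D ->
  frobenius_norm (mpinv A *m D) < frobenius_norm Y.
Proof.
move=> <- neY; rewrite mulmxA in neY *.
have PT : (mpinv A *m A)^T = mpinv A *m A by case: (mpinvP A).
move: PT (proj_idem A) neY; move: (mpinv A *m A) => P PT PP neY.
rewrite !frobenius_normE ltr_sqrt; last first.
  rewrite sqnorm_gt0; apply: contraNneq neY => ->.
  by rewrite mulmx0.
rewrite -[Y in ltRHS](subrK (P *m Y)) addrC sqnormD.
have -> : \tr ((P *m Y)^T *m (Y - P *m Y)) = 0.
  by rewrite trmx_mul PT -mulmxA mulmxBr mulmxA PP subrr mulmx0 mxtrace0.
by rewrite mulr0 addr0 ltrDl sqnorm_gt0 subr_eq0.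
Qed.

End Pseudoinverse.

(** * One cycle as a triangular solve *)

Section Cycle.
Variables (R : realType) (m p : nat) (A : 'M[R]_(m, p)) (alpha : R).
Hypothesis A_rows : forall i : 'I_m, row i A != 0.
Hypothesis alpha_neq0 : alpha != 0.

Lemma gram_diag i : (A *m A^T) i i = sqnorm (row i A).
Proof.
rewrite sqnormE big_ord1 mxE; apply: eq_bigr => j _.
by rewrite !mxE expr2.
Qed.

Lemma gram_diag_gt0 i : 0 < (A *m A^T) i i.
Proof. by rewrite gram_diag sqnorm_gt0. Qed.

Lemma LmxE i j : Lmx alpha A i j =
  if (j < i)%N then (A *m A^T) i j
  else if i == j then alpha^-1 * (A *m A^T) i i else 0.
Proof.
rewrite /Lmx /strict_lower /diag_part; move: (A *m A^T) => G; rewrite !mxE.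
have [<-|nij] := eqVneq i j; first by rewrite ltnn add0r.
by rewrite mulr0 addr0.
Qed.

Lemma Lmx_unit : Lmx alpha A \in unitmx.
Proof.
rewrite unitmxE det_trig; last first.
  apply/is_trig_mxP => i j ij; rewrite LmxE ltnNge (ltnW ij)/=.
  by rewrite -val_eqE (ltn_eqF ij).
rewrite unitfE; apply/prodf_neq0 => i _.
by rewrite LmxE ltnn eqxx mulf_neq0 ?invr_neq0// gt_eqF// gram_diag_gt0.
Qed.

(** By forward substitution: the residual at row [k] after the first [k] updates
    is the residual of [X] minus the terms [j < k] of row [k] of [L Z], and
    [L Z = D - A X] identifies it with the diagonal term. *)
Lemma BK_partial_cycle q (D : 'M[R]_(m, q)) (X : 'M[R]_(p, q)) k :
  let Z := invmx (Lmx alpha A) *m (D - A *m X) in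
  (k <= m)%N ->
  foldl (BK_step alpha A D) X (take k (enum 'I_m)) =
  X + \sum_(i < m | (i < k)%N) (row i A)^T *m row i Z.
Proof.
move=> Z; elim: k => [|k IHk] km.
  by rewrite take0/= big_pred0 ?addr0.
pose i0 := Ordinal km.
have LZ : row i0 (Lmx alpha A *m Z) = row i0 (D - A *m X).
  by rewrite /Z mulKVmx ?Lmx_unit.
rewrite (take_nth i0) ?size_enum_ord// -cats1 foldl_cat/= IHk ?(ltnW km)//.
have -> : nth i0 (enum 'I_m) k = i0 by apply: val_inj; rewrite /= nth_enum_ord.
rewrite [in RHS](bigD1 i0)/=; last by rewrite ltnS.
have -> : \sum_(i < m | (i < k.+1)%N && (i != i0)) (row i A)^T *m row i Z =
    \sum_(i < m | (i < k)%N) (row i A)^T *m row i Z.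
  apply: eq_bigl => i; rewrite -val_eqE/= ltnS.
  by rewrite andbC -ltn_neqAle.
set S := \sum_(i < m | _) _.
rewrite /BK_step -addrA [S + _]addrC; congr (_ + (_ + _)).
(* the remaining residual is the diagonal term of row k of L Z *)
have -> : row i0 D - row i0 A *m (X + S) =
    (alpha^-1 * sqnorm (row i0 A)) *: row i0 Z.
  have AS : row i0 A *m S =
      \sum_(i < m | (i < k)%N) (A *m A^T) i0 i *: row i Z.
    rewrite mulmx_sumr; apply: eq_bigr => i _.
    rewrite mulmxA [X in X *m _](_ : _ = ((A *m A^T) i0 i)%:M) ?mul_scalar_mx//.
    rewrite tr_row -row_mul; apply/matrixP => a b; rewrite !ord1.
    by rewrite !mxE eqxx mulr1n; apply: eq_bigr => l _; rewrite !mxE.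
  have : row i0 (Lmx alpha A *m Z) = row i0 A *m S +
      (alpha^-1 * sqnorm (row i0 A)) *: row i0 Z.
    rewrite AS -gram_diag row_mul mulmx_sum_row (bigD1 i0)//= addrC.
    congr (_ + _); last by rewrite mxE LmxE ltnn eqxx.
    rewrite (bigID (fun i : 'I_m => (i < k)%N))/= [X in _ + X]big1 ?addr0.
      apply: eq_big => i; first by rewrite -val_eqE/=; case: ltngtP.
      by move=> /andP[_ ik]; rewrite mxE LmxE/= ik.
    move=> i /andP[ii0 ik]; rewrite mxE LmxE/= (negbTE ik) eq_sym (negbTE ii0).
    by rewrite scale0r.
  rewrite LZ mulmxDr linearB/= row_mul => /eqP.
  rewrite [X in _ == X]addrC -subr_eq => /eqP <-.
  by rewrite opprD addrA.
rewrite frobenius_normE sqr_sqrtr ?sqnorm_ge0// -scalemxAr scalerA.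
by rewrite mulrACA mulfV// mulVf ?mulr1 ?scale1r// gt_eqF// sqnorm_gt0.
Qed.

Lemma BK_cycleE q (D : 'M[R]_(m, q)) (X : 'M[R]_(p, q)) :
  BK_cycle alpha A D X =
  X + A^T *m invmx (Lmx alpha A) *m (D - A *m X).
Proof.
have := BK_partial_cycle D X (leqnn m).
rewrite -[X in take X _](size_enum_ord m) take_size /BK_cycle => ->.
congr (_ + _); rewrite -mulmxA; set Z := _ *m (D - _).
rewrite (eq_bigl xpredT) => [|i]; last by rewrite ltn_ord.
apply/matrixP => a b; rewrite summxE mxE; apply: eq_bigr => i _.
by rewrite !mxE big_ord1 !mxE.
Qed.

End Cycle.

(** * Contraction on the row space of A *)

Section Contraction.
Variables (R : realType) (m p : nat) (A : 'M[R]_(m, p)) (alpha : R).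
Hypothesis A_rows : forall i : 'I_m, row i A != 0.
Hypothesis alpha02 : 0 < alpha < 2.

Let L := Lmx alpha A.
Let M := 1%:M - A^T *m invmx L *m A.
Let P := mpinv A *m A.

(** The off-diagonal parts cancel because [A A^T] is symmetric; the diagonal of
    [A A^T] is counted [1 / alpha + 1 / alpha - 1] times. *)
Lemma Lmx_add_tr : L + L^T - A *m A^T =
  diag_mx (\row_i ((2 / alpha - 1) * (A *m A^T) i i)).
Proof.
have GT i j : (A *m A^T) i j = (A *m A^T) j i.
  have /matrixP/(_ j i) : (A *m A^T)^T = A *m A^T by rewrite trmx_mul trmxK.
  by rewrite [LHS]mxE.
have LE := LmxE A alpha; rewrite /L; move: (Lmx alpha A) (A *m A^T) GT LE.
move=> T G GT LE; apply/matrixP => i j; rewrite !mxE !LE (GT j i) (eq_sym j).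
case: ltngtP => [ij|ji|/val_inj ->]; last by rewrite eqxx mulr1n; ring.
- by rewrite -val_eqE (gtn_eqF ij) mulr0n; ring.
- by rewrite -val_eqE (ltn_eqF ji) mulr0n; ring.
Qed.

(** The diagonal of the square root of [L + L^T - A A^T]. *)
Let weight : 'rV[R]_m :=
  \row_i Num.sqrt ((2 / alpha - 1) * (A *m A^T) i i).

Lemma weightE i :
  weight 0 i = Num.sqrt ((2 / alpha - 1) * (A *m A^T) i i).
Proof. by rewrite [LHS]mxE. Qed.

Lemma weight_arg_gt0 i : 0 < (2 / alpha - 1) * (A *m A^T) i i.
Proof.
case/andP: alpha02 => a0 a2; rewrite mulr_gt0 ?gram_diag_gt0//.
by rewrite subr_gt0 ltr_pdivlMr// mul1r.
Qed.

(** Expanding [|X - A^T Z|^2] with [A X = L Z], the cross term is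
    [tr (Z^T (L + L^T) Z)] and the square term is [tr (Z^T A A^T Z)]. *)
Lemma sqnorm_sweep q (X : 'M[R]_(p, q)) :
  sqnorm (M *m X) =
  sqnorm X - sqnorm (diag_mx weight *m (invmx L *m (A *m X))).
Proof.
case/andP: alpha02 => a0 a2.
set Z := invmx L *m _.
have uL : L \in unitmx by rewrite Lmx_unit// gt_eqF.
have MX : M *m X = X + - (A^T *m Z).
  by rewrite /M mulmxBl mul1mx /Z !mulmxA.
have AX : A *m X = L *m Z by rewrite /Z mulKVmx.
clearbody Z.
have XAZ : \tr (X^T *m (A^T *m Z)) = \tr (Z^T *m L^T *m Z).
  by rewrite mulmxA -trmx_mul AX trmx_mul.
have ZLZ : \tr (Z^T *m L *m Z) = \tr (Z^T *m L^T *m Z).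
  by rewrite -[LHS]mxtrace_tr !trmx_mul trmxK mulmxA.
have W : sqnorm (diag_mx weight *m Z) = \tr (Z^T *m (L + L^T - A *m A^T) *m Z).
  rewrite /sqnorm trmx_mul tr_diag_mx Lmx_add_tr !mulmxA.
  rewrite -(mulmxA Z^T (diag_mx weight)).
  rewrite mulmx_diag; congr (\tr (_ *m diag_mx _ *m _)).
  apply/rowP => i; rewrite [LHS]mxE [RHS]mxE weightE -expr2 sqr_sqrtr//.
  exact/ltW/weight_arg_gt0.
rewrite W MX sqnormD mulmxN [\tr (- _)]raddfN/= XAZ.
have -> : sqnorm (- (A^T *m Z)) = \tr (Z^T *m (A *m A^T) *m Z).
  rewrite /sqnorm [(- _)^T]linearN/= mulNmx mulmxN opprK.
  by rewrite trmx_mul trmxK !mulmxA.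
rewrite mulmxBr mulmxDr !mulmxBl !mulmxDl [\tr (_ - _)]raddfB/= mxtraceD ZLZ.
ring.
Qed.

(** On range(A^T), [X] is recovered from the loss term by the fixed matrix
    [T = A^+ L W^(-1/2)], so the loss is at least [|X|^2 / (|T|^2 + 1)]. *)
Lemma sweep_contraction : exists2 c : R, 0 <= c < 1 &
  forall q (X : 'M[R]_(p, q)), P *m X = X -> sqnorm (M *m X) <= c * sqnorm X.
Proof.
case/andP: (alpha02) => a0 a2.
have uL : L \in unitmx by rewrite Lmx_unit// gt_eqF.
pose T := mpinv A *m L *m diag_mx (\row_i (weight 0 i)^-1).
(* adding 1 makes the denominator positive even when T = 0 *)
have K0 : 0 < sqnorm T + 1 by rewrite ltr_wpDl ?sqnorm_ge0.
exists (1 - (sqnorm T + 1)^-1).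
  rewrite ltrBlDr ltrDl invr_gt0 K0 andbT subr_ge0 invf_le1//.
  by rewrite lerDr sqnorm_ge0.
move=> q X PX; rewrite sqnorm_sweep mulrBl mul1r lerD2l lerN2.
set Y := diag_mx weight *m _.
rewrite mulrC ler_pdivrMr//.
have XT : X = T *m Y.
  rewrite /T /Y -mulmxA (mulmxA (diag_mx _) (diag_mx _)) mulmx_diag.
  rewrite (_ : diag_mx _ = 1%:M); last first.
    rewrite -diag_const_mx; congr diag_mx; apply/rowP => i.
    rewrite [LHS]mxE [RHS]mxE [X in X * _]mxE mulVf//.
    by rewrite weightE gt_eqF// sqrtr_gt0 weight_arg_gt0.
  by rewrite mul1mx -mulmxA mulKVmx// mulmxA PX.
rewrite {1}XT mulrC; apply: le_trans (sqnorm_mulmx _ _) _.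
by rewrite ler_wpM2r ?sqnorm_ge0// lerDl.
Qed.

End Contraction.

(** * Spectral radius *)

Section SpectralRadius.
Variable R : realType.

(** [E] intertwines [N] with [T], so [N] is [T] restricted to the row space of
    [E]; for a left eigenvector [a + i b] of [N] with eigenvalue [z], the
    estimates for [a E] and [b E] add up to [|z|^2 <= c]. *)
Lemma spectral_radius_lt1 k p (N : 'M[R]_k) (E : 'M[R]_(k, p)) (T : 'M[R]_p)
    (c : R) :
  0 <= c < 1 -> row_free E -> N *m E = E *m T ->
  (forall u : 'rV[R]_k, sqnorm (u *m E *m T) <= c * sqnorm (u *m E)) ->
  spectral_radius N < 1.
Proof.
move=> /andP[c0 c1] freeE NE cT; rewrite /spectral_radius.
set S := [set _ | _ in _].
have [->|/set0P S0] := eqVneq S set0; first by rewrite sup0.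
apply: (@le_lt_trans _ _ (Num.sqrt c)); last first.
  by rewrite -[ltRHS]sqrtr1 ltr_sqrt.
apply: ge_sup => // _ [[x y]/= /eigenvalueP[v vN v0] <-] /=.
rewrite ler_sqrt//.
pose a : 'rV[R]_k := \row_j complex.Re (v 0 j).
pose b : 'rV[R]_k := \row_j complex.Im (v 0 j).
have aN : a *m N = x *: a - y *: b.
  apply/rowP => j; move/rowP/(_ j)/(congr1 (@complex.Re R)): vN.
  rewrite !mxE raddf_sum/=; case: (v 0 j) => r i /= <-.
  apply: eq_bigr => l _; rewrite !mxE; case: (v 0 l) => ? ? /=.
  by rewrite mulr0 subr0.
have bN : b *m N = x *: b + y *: a.
  apply/rowP => j; move/rowP/(_ j)/(congr1 (@complex.Im R)): vN.
  rewrite !mxE raddf_sum/=; case: (v 0 j) => r i /= <-.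
  apply: eq_bigr => l _; rewrite !mxE; case: (v 0 l) => ? ? /=.
  by rewrite mulr0 add0r.
have := lerD (cT a) (cT b).
rewrite -mulrDr -!mulmxA -NE !mulmxA aN bN mulmxBl mulmxDl -!scalemxAl.
rewrite sqnorm_complexZ ler_pM2r// lt_def addr_ge0 ?sqnorm_ge0// andbT.
apply: contraNneq v0 => /eqP; rewrite paddr_eq0 ?sqnorm_ge0// !sqnorm_eq0.
case/andP => /eqP aE /eqP bE.
have a0 : a = 0 by apply: (row_free_inj freeE); rewrite mul0mx.
have b0 : b = 0 by apply: (row_free_inj freeE); rewrite mul0mx.
apply/eqP/rowP => j.
move/rowP/(_ j): a0; move/rowP/(_ j): b0; rewrite !mxE.
by case: (v 0 j) => r i /= -> ->.
Qed.

Lemma eigenvalue_tr (F : fieldType) k (g : 'M[F]_k) a :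
  eigenvalue g^T a = eigenvalue g a.
Proof.
rewrite /eigenvalue /eigenspace !kermx_eq0 !row_free_unit -unitmx_tr.
by rewrite linearB/= trmxK tr_scalar_mx.
Qed.

Lemma spectral_radius_tr k (N : 'M[R]_k) :
  spectral_radius N^T = spectral_radius N.
Proof.
have E : eigenvalue (map_mx (real_complex R) N^T) =
    eigenvalue (map_mx (real_complex R) N).
  by apply/funext => z; rewrite -map_trmx eigenvalue_tr.
by rewrite /spectral_radius E.
Qed.

End SpectralRadius.

(** * Fixed points and convergence *)

Lemma cvg_mx_geometric (R : realType) p q (u : nat -> 'M[R]_(p, q))
    (l : 'M[R]_(p, q)) (c K : R) :
  0 <= c < 1 -> (forall s, sqnorm (u s - l) <= c ^+ s * K) ->
  u s @[s --> \oo] --> l.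
Proof.
move=> /andP[c0 c1] uK; apply/cvg_ballP => e e0.
have /cvgrPdist_lt/(_ (e ^+ 2)) : (c ^+ s * K) @[s --> \oo] --> 0 * K.
  by apply: cvgM; [apply: cvg_expr; rewrite ger0_norm|exact: cvg_cst].
rewrite exprn_gt0// => /(_ isT); apply: filterS => s.
rewrite mul0r sub0r normrN => se; split=> // i j.
rewrite /ball/= -(ltr_pXn2r (ltn0Sn 1)) ?nnegrE ?(ltW e0)//.
rewrite real_normK ?num_real//.
have -> : (l i j - u s i j) ^+ 2 = (u s - l) i j ^+ 2.
  by rewrite !mxE -[RHS]sqrrN opprB.
apply: le_lt_trans (sqr_entry_le _ _ _) _.
exact: le_lt_trans (uK s) (le_lt_trans (ler_norm _) se).
Qed.

Section FixedPoint.
Variables (R : realType) (m p : nat) (A : 'M[R]_(m, p)) (alpha : R).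
Hypothesis A_rows : forall i : 'I_m, row i A != 0.
Hypothesis alpha02 : 0 < alpha < 2.

Let H := A^T *m invmx (Lmx alpha A).
Let M := 1%:M - H *m A.
Let P := mpinv A *m A.

Lemma proj_step : P *m H = H.
Proof. by rewrite /H mulmxA proj_trmx. Qed.

Lemma proj_sweep q (X : 'M[R]_(p, q)) : P *m X = X -> P *m (M *m X) = M *m X.
Proof.
move=> PX; rewrite /M mulmxBl mul1mx mulmxBr PX; congr (_ - _).
by rewrite -(mulmxA H) (mulmxA P H) proj_step.
Qed.

(** A vector killed by [1 - M P] lies in range(A^T) and is fixed by [M], hence
    is zero by contraction. So [Y = M P Y + H D] has a solution, and both terms
    on the right are in range(A^T). *)
Lemma sweep_fixed q (D : 'M[R]_(m, q)) :
  exists2 Y : 'M[R]_(p, q), P *m Y = Y & H *m (D - A *m Y) = 0.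
Proof.
have [c /andP[c0 c1] cM] := sweep_contraction A_rows alpha02.
have uU : 1%:M - M *m P \in unitmx.
  rewrite -unitmx_tr -row_free_unit -kermx_eq0.
  set W := kermx _.
  have MPW : W^T = M *m (P *m W^T).
    apply/eqP; rewrite mulmxA -subr_eq0 -{1}[W^T]mul1mx -mulmxBl.
    by rewrite -[X in X *m _]trmxK -trmx_mul mulmx_ker trmx0.
  have PW : P *m W^T = W^T.
    by rewrite MPW proj_sweep// mulmxA proj_idem.
  have := cM _ _ PW; rewrite -{1}[in M *m _]PW -MPW.
  rewrite -subr_le0 -{1}[sqnorm _]mul1r -mulrBl pmulr_rle0 ?subr_gt0// => W0.
  by rewrite -trmx_eq0 -sqnorm_eq0 eq_le W0 sqnorm_ge0.
pose Y := invmx (1%:M - M *m P) *m (H *m D).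
have YE : Y = M *m (P *m Y) + H *m D.
  have : (1%:M - M *m P) *m Y = H *m D by rewrite /Y mulKVmx.
  by rewrite mulmxBl mul1mx -(mulmxA M) => <-; rewrite addrCA subrr addr0.
have PY : P *m Y = Y.
  rewrite YE mulmxDr proj_sweep ?[P *m (P *m _)]mulmxA ?proj_idem//.
  congr (_ + _).
  by rewrite (mulmxA P H) proj_step.
exists Y => //; apply/(addrI Y); rewrite addr0 [in RHS]YE PY /M.
by rewrite mulmxBl mul1mx mulmxBr mulmxA addrA addrAC.
Qed.

(** The component [X0 - P X0] in the null space of [A] is never changed.
    Relative to the limit the iteration is linear, [X - l |-> M (X - l)], and
    the error stays in range(A^T), where [M] contracts. *)
Lemma BK_cvg q (D : 'M[R]_(m, q)) (X0 Y : 'M[R]_(p, q)) :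
  P *m Y = Y -> H *m (D - A *m Y) = 0 ->
  BK alpha A D X0 s @[s --> \oo] --> X0 - P *m X0 + Y.
Proof.
move=> PY HY; set l := _ + Y.
have [c c01 cM] := sweep_contraction A_rows alpha02.
have a0 : alpha != 0 by case/andP: alpha02 => a0 _; rewrite gt_eqF.
apply: (@cvg_mx_geometric _ _ _ _ _ c (sqnorm (X0 - l))) => //.
have Al : A *m l = A *m Y.
  by rewrite /l mulmxDr mulmxBr mulmxA mulmx_proj subrr add0r.
(* the contraction estimate applies only to errors fixed by P *)
move=> s; have [] // : P *m (BK alpha A D X0 s - l) = BK alpha A D X0 s - l /\
  sqnorm (BK alpha A D X0 s - l) <= c ^+ s * sqnorm (X0 - l).
elim: s => [|s [Ps cs]].
  rewrite expr0 mul1r lexx; split=> //=.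
  have -> : X0 - l = P *m X0 - Y.
    by rewrite /l opprD opprB addrA [X0 + _]addrC subrK.
  by rewrite mulmxBr PY mulmxA proj_idem.
have step : BK alpha A D X0 s.+1 - l = M *m (BK alpha A D X0 s - l).
  rewrite {1}/BK iterS -/(BK alpha A D X0 s) BK_cycleE// -/H.
  set X := BK _ _ _ _ _.
  rewrite /M mulmxBl mul1mx addrAC; congr (_ + _).
  rewrite -(mulmxA H A) (mulmxBr A) Al -[RHS]mulmxN opprB.
  by rewrite -[D](subrK (A *m Y)) -addrA mulmxDr HY add0r.
split; first by rewrite step proj_sweep.
rewrite step exprS -mulrA; apply: le_trans (cM _ _ Ps) _.
by case/andP: c01 => c0 _; rewrite ler_wpM2l.
Qed.

End FixedPoint.

(** * Convergence of block Kaczmarz *)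

Theorem theorem3p6 (R : realType) (m n p q : nat)
    (A : 'M[R]_(m, p)) (B : 'M[R]_(q, n)) (C : 'M[R]_(m, n)) (alpha : R)
    (A_rows : forall i : 'I_m, row i A != 0)
    (B_full : row_free B)
    (alpha_neq0 : alpha != 0) :
  let D := Ctilde B C in
  let L := Lmx alpha A in
  let M := 1%:M - A^T *m invmx L *m A in
  (L \in unitmx /\
   forall X : 'M[R]_(p, q),
     BK_cycle alpha A D X = X + A^T *m invmx L *m (D - A *m X)) /\
  (0 < alpha < 2 ->
    [/\ forall X0 : 'M[R]_(p, q), cvg (BK alpha A D X0 s @[s --> \oo]),
        (* M fixes the null space of A pointwise, so 1 is an eigenvalue of M
           unless A has full column rank, i.e. range(A^T) is everything *)
        spectral_radius_on A^T M < 1 /\ (row_full A -> spectral_radius M < 1),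
        consistent A B C ->
          forall X0 : 'M[R]_(p, q), exists2 X : 'M[R]_(p, q),
            is_solution A B C X & BK alpha A D X0 s @[s --> \oo] --> X
      & consistent A B C ->
          forall X0 : 'M[R]_(p, q), range_sub X0 A^T -> range_sub X0^T B ->
          [/\ BK alpha A D X0 s @[s --> \oo] --> mpinv A *m D,
              mpinv A *m D = mpinv A *m C *m mpinv B
            & is_min_norm_solution A B C (mpinv A *m D)]]).
Proof.
move=> D L M; split.
  by split=> [|X]; [exact: Lmx_unit|exact: BK_cycleE].
move=> alpha02; set P := mpinv A *m A.
have [c c01 cM] := sweep_contraction A_rows alpha02.
have sol_pinv : consistent A B C -> A *m (mpinv A *m D) = D.
  case=> X /(Ctilde_sol _ _ _ B_full)[AX _].
  by rewrite -[D]AX (mulmxA (mpinv A)) [LHS]mulmxA mulmx_proj.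
have lim_consistent X0 : consistent A B C ->
    BK alpha A D X0 s @[s --> \oo] --> X0 - P *m X0 + mpinv A *m D.
  move=> /sol_pinv AD; apply: BK_cvg => //; last by rewrite AD subrr mulmx0.
  by rewrite mulmxA; case: (mpinvP A) => _ ->.
split.
- move=> X0; have [Y PY HY] := sweep_fixed A_rows alpha02 D.
  exact: cvgP (BK_cvg A_rows alpha02 PY HY).
- split.
    rewrite /spectral_radius_on trmxK.
    set E := row_base A.
    have EA : (E <= A)%MS by rewrite eq_row_base.
    have ME : (E *m M^T <= E)%MS.
      rewrite eq_row_base /M linearB/= trmx1 mulmxBr mulmx1 addmx_sub//.
      rewrite eqmx_opp trmx_mul mulmxA mulmx_sub//.
      by rewrite trmx_mul trmxK submxMl.
    apply: (spectral_radius_lt1 (E := E) (T := M^T) c01 (row_base_free A)).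
      by rewrite -/E; exact: mulmxKpV.
    move=> u; have /submxP[w uE] : (u *m E <= A)%MS by rewrite mulmx_sub.
    rewrite uE -(sqnorm_tr (_ *m M^T)) -(sqnorm_tr (w *m A)) trmx_mul trmxK.
    by apply: cM; rewrite trmx_mul mulmxA proj_trmx.
  (* M acts on columns and the eigenvectors are rows, whence the transpose *)
  move=> /row_fullP[G GA]; rewrite -spectral_radius_tr.
  have P1 : P = 1%:M by rewrite -[P]mul1mx -GA -mulmxA mulmx_proj.
  apply: (spectral_radius_lt1 (E := 1%:M) (T := M^T) c01).
  + by rewrite row_free_unit unitmx1.
  + by rewrite mulmx1 mul1mx.
  + move=> u; rewrite mulmx1 -(sqnorm_tr (_ *m M^T)) -(sqnorm_tr u).
    by rewrite trmx_mul trmxK; apply: cM; rewrite -/P P1 mul1mx.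
- move=> cons X0; eexists; last exact: lim_consistent.
  apply/Ctilde_sol => //; split=> //.
  by rewrite mulmxDr sol_pinv// mulmxBr mulmxA mulmx_proj subrr add0r.
- move=> cons X0 X0A _; split.
  + have /submxP[w /(congr1 trmx)] := X0A.
    rewrite trmxK trmxK trmx_mul => X0E.
    have PX0 : P *m X0 = X0 by rewrite X0E mulmxA proj_trmx.
    by have := lim_consistent X0 cons; rewrite PX0 subrr add0r.
  + by rewrite (mpinv_row_free B_full) /D /Ctilde !mulmxA.
  + split; first by apply/Ctilde_sol => //; split=> //; exact: sol_pinv.
    move=> Y /(Ctilde_sol _ _ _ B_full)[AY _] neY.
    exact: min_norm_mpinv.
Qed.
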